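(* Let $K_t, S, M, N$ be positive integers, $P_T>0$, $\sigma^2>0$, and let $\Lambda_1,\dots,\Lambda_S\ge 0$ with $\sum_{s}\Lambda_s=1$. Let $\bm{H}$ be the random $S\times K_t$ complex matrix with entries $$[\bm{H}]_{s,k}=h^{(s,k)}=\sqrt{\hat\beta^{(s)}}\sum_{m=1}^{M}\sum_{n=1}^{N} g_{m,n}^{(s,k)}\,\Gamma_{m,n}^{(s)},$$ where $\hat\beta^{(s)}>0$ are constants, the small-scale fading coefficients $g_{m,n}^{(s,k)}$ are independent complex random variables with mean $0$ and variance $1$, and the surface responses $\Gamma_{m,n}^{(s)}$ are deterministic complex numbers whose modulus $|\Gamma_{m,n}^{(s)}|$ does not depend on $(m,n)$. Define the capacity $$C=\mathbb{E}\Big(\sum_{s=1}^{S}\log_2\Big(1+\frac{P_T}{\sigma^2}\Lambda_s[\bm{H}\bm{H}^{\mathrm{H}}]_{s,s}\Big)\Big).$$ Then $$C\le \sum_{s=1}^{S}\log_2\Big(1+\frac{P_T}{\sigma^2}\Lambda_s\,\hat\beta^{(s)}K_tMN\,|\Gamma_{m,n}^{(s)}|^2\Big).$$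
   Context: The setting is a downlink with a base station with $K_t$ antennas, $S$ single-antenna users, and a reconfigurable intelligent surface with $M\times N$ elements; the direct link is blocked. $\bm{H}^{\mathrm{H}}$ denotes the conjugate transpose. The variance of a mean-zero complex random variable $g$ is $\mathbb{E}|g|^2$. Here $\hat\beta^{(s)}$ is the average path loss of user $s$, and $\Gamma_{m,n}^{(s)}$ is the coefficient $\Gamma e^{-j\varphi_{m,n}}$ of element $(m,n)$ seen by user $s$, with amplitude $\Gamma=|\Gamma_{m,n}^{(s)}|\ge 0$ common to all elements $(m,n)$ and phase shift $\varphi_{m,n}$. *)

(* Defs.v *)
From HB Require Import structures.
From mathcomp Require Import all_boot all_order all_algebra.
From mathcomp Require Import sesquilinear spectral complex.
From mathcomp Require Import all_classical all_reals all_analysis.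

Set Implicit Arguments.
Unset Strict Implicit.
Unset Printing Implicit Defensive.

Import Order.TTheory GRing.Theory Num.Theory.
Import numFieldNormedType.Exports.

Local Open Scope classical_set_scope.
Local Open Scope ring_scope.
Local Open Scope complex_scope.
Local Open Scope sesquilinear_scope.

Notation cRe := (@complex.Re _).
Notation cIm := (@complex.Im _).
Notation cmod := ComplexField.Normc.normc.

Definition log2 {R : realType} (x : R) : R := ln x / ln 2.

Section complex_random_variables.
Context {d : measure_display} {T : measurableType d} {R : realType}.
Variable P : probability T R.

(* C is identified with R * R, whose product sigma-algebra is the Borel one. *)
Definition coords (z : R[i]) : R * R := (cRe z, cIm z).

Definition complex_RV (X : T -> R[i]) : Prop :=
  measurable_fun [set: T] (coords \o X).

Definition has_mean (X : T -> R[i]) (mu : R[i]) : Prop :=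
  [/\ P.-integrable [set: T] (EFin \o (cRe \o X)),
      P.-integrable [set: T] (EFin \o (cIm \o X)),
      'E_P[cRe \o X]%E = (cRe mu)%:E
    & 'E_P[cIm \o X]%E = (cIm mu)%:E].

(* The variance of X, provided X has mean mu. *)
Definition variance_about (mu : R[i]) (X : T -> R[i]) : \bar R :=
  'E_P[(fun w => cmod (X w - mu) ^+ 2)%R]%E.

(* Mutual (not merely pairwise) independence. *)
Definition independent_family (I : finType) (X : I -> T -> R[i]) : Prop :=
  forall (J : {set I}) (B : I -> set (R * R)),
    (forall i, measurable (B i)) ->
    P [set w | forall i, i \in J -> B i (coords (X i w))] =
    (\prod_(i in J) P [set w | B i (coords (X i w))])%E.

End complex_random_variables.

Section ris_downlink.
Context {d : measure_display} {T : measurableType d} {R : realType}.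
Variables (S Kt M N : nat).

Definition channel (beta : 'I_S -> R)
    (g : 'I_S -> 'I_Kt -> 'I_M -> 'I_N -> T -> R[i])
    (Gam : 'I_S -> 'I_M -> 'I_N -> R[i]) (w : T) : 'M[R[i]]_(S, Kt) :=
  \matrix_(s < S, k < Kt)
    ((Num.sqrt (beta s))%:C *
     \sum_(m < M) \sum_(n < N) g s k m n w * Gam s m n).

(* The diagonal entries of H H^H are real, so Re only changes their type.
   The expectation is that of a nonnegative function and may a priori be +oo. *)
Definition capacity (P : probability T R) (PT sigma2 : R) (Lam : 'I_S -> R)
    (H : T -> 'M[R[i]]_(S, Kt)) : \bar R :=
  'E_P[(fun w => \sum_(s < S)
         log2 (1 + PT / sigma2 * Lam s *
                   cRe ((H w *m (H w)^t*) s s)))%R]%E.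

End ris_downlink.

(* Main.v *)
(* The entries of H are sums of pairwise uncorrelated terms, so the expected
   value of the s-th diagonal entry of H H^H is
   beta_s Kt M N |Gamma^(s)|^2. Jensen's inequality for the concave logarithm
   then bounds each summand of the capacity. *)
Require Import Defs.
From HB Require Import structures.
From mathcomp Require Import all_boot all_order all_algebra.
From mathcomp Require Import sesquilinear spectral complex.
From mathcomp Require Import measurable_realfun ring.
From mathcomp Require Import all_classical all_reals all_analysis.

Set Implicit Arguments.
Unset Strict Implicit.
Unset Printing Implicit Defensive.

Import Order.TTheory GRing.Theory Num.Theory.
Import numFieldNormedType.Exports.

Local Open Scope classical_set_scope.
Local Open Scope ring_scope.
Local Open Scope complex_scope.
Local Open Scope sesquilinear_scope.


(** * Real random variables with a finite mean *)

Section mean.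
Context {d : measure_display} {T : measurableType d} {R : realType}.
Variable P : probability T R.

Lemma expectation_integral (X : T -> R) :
  ('E_P[X] = \int[P]_w (X w)%:E)%E.
Proof. by rewrite unlock. Qed.

(** Integrability travels with the value: it supplies measurability and is what linearity of the
    integral asks for. *)
Definition mean_is (X : T -> R) (c : R) : Prop :=
  P.-integrable [set: T] (EFin \o X) /\ 'E_P[X]%E = c%:E.

Lemma mean_is_measurable X c : mean_is X c -> measurable_fun [set: T] X.
Proof. by move=> [/measurable_int/measurable_EFinP]. Qed.

Lemma mean_is_cst c : mean_is (fun=> c) c.
Proof.
split; last exact: expectation_cst.
exact: (finite_measure_integrable_cst P c measurableT).
Qed.

Lemma mean_isD X Y a b :
  mean_is X a -> mean_is Y b -> mean_is (fun w => X w + Y w) (a + b).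
Proof.
rewrite /mean_is !expectation_integral => -[iX EX] [iY EY]; split.
  exact: (integrableD measurableT iX iY).
by rewrite (integralD measurableT iX iY) EX EY.
Qed.

Lemma mean_isZ k X a : mean_is X a -> mean_is (fun w => k * X w) (k * a).
Proof.
rewrite /mean_is !expectation_integral => -[iX EX]; split.
  exact: (integrableZl measurableT k iX).
by rewrite (integralZl measurableT iX) EX.
Qed.

Lemma mean_is_sum (I : Type) (r : seq I) (X : I -> T -> R) (c : I -> R) :
  (forall i, mean_is (X i) (c i)) ->
  mean_is (fun w => \sum_(i <- r) X i w) (\sum_(i <- r) c i).
Proof.
move=> Xc; elim: r => [|i r IH].
  rewrite big_nil (_ : (fun _ => _) = fun=> 0); first exact: mean_is_cst.
  by apply/funext => w; rewrite big_nil.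
rewrite big_cons (_ : (fun _ => _) = fun w => X i w + \sum_(j <- r) X j w).
  exact: mean_isD.
by apply/funext => w; rewrite big_cons.
Qed.

(* The joint law of an independent pair is the product of the marginals, so
   Fubini applies. *)
Lemma mean_isM_indep X Y a b :
  (forall A B : set R, measurable A -> measurable B ->
     P (X @^-1` A `&` Y @^-1` B) = (P (X @^-1` A) * P (Y @^-1` B))%E) ->
  mean_is X a -> mean_is Y b -> mean_is (fun w => X w * Y w) (a * b).
Proof.
move=> indep mX' mY'.
have mX := mean_is_measurable mX'; have mY := mean_is_measurable mY'.
have mZ : measurable_fun [set: T] (fun w => (X w, Y w)).
  exact: measurable_fun_pair.
move: mX' mY'; rewrite /mean_is !expectation_integral => -[iX EX] [iY EY].
pose X' : {RV P >-> R} := HB.pack X (isMeasurableFun.Build _ _ _ _ _ mX).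
pose Y' : {RV P >-> R} := HB.pack Y (isMeasurableFun.Build _ _ _ _ _ mY).
pose Z' : {RV P >-> (R * R)%type} :=
  HB.pack (fun w => (X w, Y w)) (isMeasurableFun.Build _ _ _ _ _ mZ).
pose f : R * R -> \bar R := EFin \o (fun z => z.1 * z.2).
have mf : measurable_fun [set: R * R] f.
  apply/measurable_EFinP/measurable_funM; first exact: measurable_fst.
  exact: measurable_snd.
have mid : measurable_fun [set: R] (@EFin R) by [].
have mabs : measurable_fun [set: R] (fun x : R => `|x|%:E).
  apply: measurableT_comp (@EFin_measurable R setT) _.
  exact: normr_measurable.
have iPX : (distribution P X').-integrable [set: R] EFin.
  exact: (integrable_pushforward mX mid iX measurableT).
have iPY : (distribution P Y').-integrable [set: R] EFin.
  exact: (integrable_pushforward mY mid iY measurableT).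
(* A measure that agrees with the product on rectangles is the product; on rectangles this is the
   independence hypothesis. *)
have joint A : measurable A ->
    (distribution P X' \x distribution P Y')%E A = distribution P Z' A.
  apply: product_measure_unique => B C mB mC; exact: indep.
have absfin : (\int[distribution P X']_x `|x%:E| < +oo)%E.
  by have /integrableP[] := iPX.
have absfinY : (\int[distribution P Y']_x `|x%:E| < +oo)%E.
  by have /integrableP[] := iPY.
(* By Tonelli the integral of [|x * y|] is the product of the two first absolute moments, both
   finite. *)
have intXY : (distribution P X' \x distribution P Y')%E.-integrable setT f.
  apply/integrable12ltyP => //.
  under eq_integral => x _.
    under eq_integral => y _ do rewrite /f /= normrM EFinM.
    rewrite ge0_integralZl//.
    over.
  rewrite /= ge0_integralZr//; first 1 last.
    exact: integral_ge0.
    by rewrite lte_mul_pinfty// ?integral_ge0// ge0_fin_numE// integral_ge0.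
have intZ : (distribution P Z').-integrable setT f.
  apply/integrableP; split => //.
  have /integrableP[_] := intXY.
  rewrite (eq_measure_integral (distribution P Z'))// => A mA _.
  exact: joint.
have intP : P.-integrable setT (EFin \o (fun w => X w * Y w)).
  apply/integrableP; split; first exact/measurable_EFinP/measurable_funM.
  have /integrableP[_] := intZ.
  by rewrite ge0_integral_distribution//; exact: measurableT_comp.
split => //.
transitivity (\int[distribution P Z']_z f z)%E.
  by rewrite integral_distribution.
rewrite -(eq_measure_integral (distribution P Z') (fun A mA _ => joint A mA)).
rewrite -integral12_prod_meas1// /fubini_F.
have EX' : (\int[distribution P X']_x x%:E = a%:E)%E.
  by rewrite integral_distribution.
have EY' : (\int[distribution P Y']_x x%:E = b%:E)%E.
  by rewrite integral_distribution.
(* The inner integral over [y] is [x * b], and the outer one then gives [a * b]. *)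
under eq_integral => x _.
  under eq_integral => y _ do rewrite /f /= EFinM.
  rewrite integralZl// EY'.
  over.
by rewrite /= integralZr// EX'.
Qed.

End mean.

(** * Squared moduli in real coordinates *)

Section complex_modulus.
Context {R : realType}.
Implicit Types z : R[i].

Lemma normc_sqr z : cmod z ^+ 2 = cRe z ^+ 2 + cIm z ^+ 2.
Proof. by case: z => a b /=; rewrite sqr_sqrtr// addr_ge0 ?sqr_ge0. Qed.

Lemma Re_sum (I : Type) (r : seq I) (F : I -> R[i]) :
  cRe (\sum_(i <- r) F i) = \sum_(i <- r) cRe (F i).
Proof.
by rewrite (big_morph cRe (id1 := 0) (op1 := +%R))// => -[a b] [c e].
Qed.

Lemma Im_sum (I : Type) (r : seq I) (F : I -> R[i]) :
  cIm (\sum_(i <- r) F i) = \sum_(i <- r) cIm (F i).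
Proof.
by rewrite (big_morph cIm (id1 := 0) (op1 := +%R))// => -[a b] [c e].
Qed.

(** The summand is the real part of the product of [c i] times the conjugate of [c j] with [z i]
    times the conjugate of [z j]. It is laid out as real constants times sums of coordinate
    products, with [(- 1) *] for subtraction, to match [mean_isD] and [mean_isZ]. *)
Lemma normc_sqr_sum (I : finType) (z c : I -> R[i]) :
  cmod (\sum_i z i * c i) ^+ 2 =
  \sum_i \sum_j
    ((cRe (c i) * cRe (c j) + cIm (c i) * cIm (c j)) *
       (cRe (z i) * cRe (z j) + cIm (z i) * cIm (z j)) +
     (cIm (c i) * cRe (c j) - cRe (c i) * cIm (c j)) *
       (cRe (z i) * cIm (z j) + (- 1) * (cIm (z i) * cRe (z j)))).
Proof.
rewrite normc_sqr Re_sum Im_sum !expr2 !mulr_suml -big_split/=.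
apply: eq_bigr => i _; rewrite !mulr_sumr -big_split/=.
apply: eq_bigr => j _.
by case: (z i) (z j) (c i) (c j) => [a b] [a' b'] [e f] [e' f'] /=; ring.
Qed.

Lemma Re_mulmx_conj_diag (m n : nat) (A : 'M[R[i]]_(m, n)) i :
  cRe ((A *m A^t*) i i) = \sum_j cmod (A i j) ^+ 2.
Proof.
rewrite !mxE Re_sum; apply: eq_bigr => j _; rewrite !mxE -normCK.
rewrite normc_sqr; case: (A i j) => a b.
(* The generic norm takes values in [R[i]]; [normc_def] exhibits it as an embedded real square
   root. *)
by rewrite normc_def -rmorphXn/= sqr_sqrtr// addr_ge0 ?sqr_ge0.
Qed.

End complex_modulus.

(** * Second moments of linear combinations of independent variables *)

Section second_moment.
Context {d : measure_display} {T : measurableType d} {R : realType}.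
Variable P : probability T R.

Lemma independent_family_pair (I : finType) (Z : I -> T -> R[i]) i j
    (B C : set (R * R)) :
  independent_family P Z -> i != j -> measurable B -> measurable C ->
  P ((coords \o Z i) @^-1` B `&` (coords \o Z j) @^-1` C) =
  (P ((coords \o Z i) @^-1` B) * P ((coords \o Z j) @^-1` C))%E.
Proof.
move=> indep ij mB mC.
(* Away from [i] and [j] the value [C] is a filler: those indices lie outside the chosen set. *)
have := indep [set i; j]%SET (fun k => if k == i then B else C).
rewrite big_setU1/= ?inE// big_set1 eqxx eq_sym (negbTE ij) => <-; last first.
  by move=> k; case: ifP.
congr (P _); apply/seteqP; split => w /=.
  move=> [Bw Cw] k; rewrite !inE => /orP[]/eqP->; first by rewrite eqxx.
  by rewrite eq_sym (negbTE ij).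
move=> h; split; first by have := h i; rewrite !inE eqxx => /(_ isT).
by have := h j; rewrite !inE eqxx orbT eq_sym (negbTE ij) => /(_ isT).
Qed.

(** The point is integrability: a nonnegative measurable function with finite integral is
    integrable. *)
Lemma mean_is_variance (Z : T -> R[i]) :
  complex_RV Z -> variance_about P 0 Z = 1%E ->
  mean_is P (fun w => cRe (Z w) * cRe (Z w) + cIm (Z w) * cIm (Z w)) 1.
Proof.
move=> mZ; rewrite /variance_about /mean_is.
rewrite (_ : (fun w => _) =
  fun w => cRe (Z w) * cRe (Z w) + cIm (Z w) * cIm (Z w)); last first.
  by apply/funext => w; rewrite subr0 normc_sqr !expr2.
move=> VZ; split => //; move: VZ; rewrite expectation_integral => VZ.
have mRe : measurable_fun setT (cRe \o Z) := measurableT_comp measurable_fst mZ.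
have mIm : measurable_fun setT (cIm \o Z) := measurableT_comp measurable_snd mZ.
apply/integrableP; split.
  by apply/measurable_EFinP/measurable_funD; apply: measurable_funM.
under eq_integral => w _.
  rewrite /= ger0_norm; last by rewrite addr_ge0// -expr2 sqr_ge0.
  over.
by rewrite VZ ltry.
Qed.

(* Distinct [Z i], [Z j] are uncorrelated, so only the diagonal of the double
   sum survives. *)
Lemma mean_is_normc_sqr_sum (I : finType) (Z : I -> T -> R[i])
    (c : I -> R[i]) :
  (forall i, complex_RV (Z i)) ->
  (forall i j (B C : set (R * R)), i != j -> measurable B -> measurable C ->
     P ((coords \o Z i) @^-1` B `&` (coords \o Z j) @^-1` C) =
     (P ((coords \o Z i) @^-1` B) * P ((coords \o Z j) @^-1` C))%E) ->
  (forall i, has_mean P (Z i) 0) ->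
  (forall i, variance_about P 0 (Z i) = 1%E) ->
  mean_is P (fun w => cmod (\sum_i Z i w * c i) ^+ 2)
    (\sum_i cmod (c i) ^+ 2).
Proof.
move=> mZ indep EZ VZ.
(* General [u] and [v] cover all four products of real and imaginary parts; independence passes to
   them through preimages. *)
have crossmean i j (u v : R * R -> R) : i != j ->
    measurable_fun setT u -> measurable_fun setT v ->
    mean_is P (fun w => u (coords (Z i w))) 0 ->
    mean_is P (fun w => v (coords (Z j w))) 0 ->
    mean_is P (fun w => u (coords (Z i w)) * v (coords (Z j w))) 0.
  move=> ij mu mv Eu Ev; rewrite -[X in mean_is _ _ X](mulr0 0).
  apply: mean_isM_indep => // A B mA mB.
  apply: (indep i j (u @^-1` A) (v @^-1` B)) => //.
    by rewrite -[X in measurable X]setTI; exact: mu.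
  by rewrite -[X in measurable X]setTI; exact: mv.
have ERe i : mean_is P (fun w => (coords (Z i w)).1) 0.
  by have [iRe _ E _] := EZ i.
have EIm i : mean_is P (fun w => (coords (Z i w)).2) 0.
  by have [_ iIm _ E] := EZ i.
have mfst : measurable_fun [set: R * R] fst := measurable_fst.
have msnd : measurable_fun [set: R * R] snd := measurable_snd.
(* A Kronecker delta turns the target into a double sum, so the means can be matched term by
   term. *)
have -> : \sum_i cmod (c i) ^+ 2 =
    \sum_i \sum_j (if i == j then cmod (c i) ^+ 2 else 0).
  apply: eq_bigr => i _; rewrite (bigD1 i)//= eqxx big1 ?addr0// => j.
  by rewrite eq_sym => /negbTE ->.
under eq_fun => w do rewrite normc_sqr_sum.
apply: mean_is_sum => i; apply: mean_is_sum => j.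
have [<-|ij] := eqVneq i j.
  (* For [i = j] the second coefficient of the expansion cancels and the first is the squared
     modulus of [c i]. *)
  have := mean_isZ (cmod (c i) ^+ 2) (mean_is_variance (mZ i) (VZ i)).
  rewrite mulr1; congr mean_is; apply/funext => w.
  by rewrite normc_sqr; ring.
have E0 := mean_isD
  (mean_isZ (cRe (c i) * cRe (c j) + cIm (c i) * cIm (c j))
    (mean_isD (crossmean _ _ _ _ ij mfst mfst (ERe i) (ERe j))
              (crossmean _ _ _ _ ij msnd msnd (EIm i) (EIm j))))
  (mean_isZ (cIm (c i) * cRe (c j) - cRe (c i) * cIm (c j))
    (mean_isD (crossmean _ _ _ _ ij mfst msnd (ERe i) (EIm j))
       (mean_isZ (-1) (crossmean _ _ _ _ ij msnd mfst (EIm i) (ERe j))))).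
by move: E0; rewrite !(mulr0, addr0).
Qed.

End second_moment.

(** * Jensen's inequality through tangent lines *)

Section jensen.
Context {R : realType}.

(** This is [ln (1 + x) <= x] at [x = (a - b) / b], which exceeds -1 because [a / b] is positive. *)
Lemma ln_le_tangent (a b : R) : 0 < a -> 0 < b -> ln a <= ln b + (a - b) / b.
Proof.
move=> a0 b0; rewrite -lerBlDl -ln_div ?posrE//.
have -> : a / b = 1 + (a - b) / b by field; rewrite gt_eqF.
apply: le_ln1Dx; rewrite mulrBl divff ?gt_eqF// ltrBrDl subrr.
exact: divr_gt0.
Qed.

Context {d : measure_display} {T : measurableType d}.
Variable P : probability T R.

Lemma mean_is_ge0 (X : T -> R) c :
  (forall w, 0 <= X w) -> mean_is P X c -> 0 <= c.
Proof.
by move=> X0 [_ EX]; rewrite -lee_fin -EX; exact: expectation_ge0.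
Qed.

Lemma log2_ge0 (x : R) : 1 <= x -> 0 <= log2 x.
Proof. by move=> x1; rewrite /log2 divr_ge0 ?ln_ge0// ler1n. Qed.

(* The logarithm lies below its tangent at the mean, whose expectation is its
   value at the mean. *)
Lemma expectation_sum_log2_le (I : finType) (X : I -> T -> R)
    (mu rho : I -> R) :
  (forall i, 0 <= rho i) -> (forall i w, 0 <= X i w) ->
  (forall i, mean_is P (X i) (mu i)) ->
  ('E_P[(fun w => \sum_i log2 (1 + rho i * X i w))%R] <=
   (\sum_i log2 (1 + rho i * mu i))%:E)%E.
Proof.
move=> rho0 X0 EX.
have mu0 i : 0 <= mu i := mean_is_ge0 (X0 i) (EX i).
have pos i (x : R) : 0 <= x -> 1 <= 1 + rho i * x.
  by move=> x0; rewrite lerDl mulr_ge0.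
have pos0 i (x : R) : 0 <= x -> 0 < 1 + rho i * x.
  by move=> x0; exact: lt_le_trans (pos i x x0).
have ln2 : 0 < ln 2 :> R by rewrite ln_gt0// ltr1n.
(* The derivative of [log2 (1 + rho i * x)] at [x = mu i]. *)
pose k i := rho i / (1 + rho i * mu i) / ln 2.
pose U i w := log2 (1 + rho i * mu i) + k i * (X i w + - mu i).
have EU : mean_is P (fun w => \sum_i U i w) (\sum_i log2 (1 + rho i * mu i)).
  apply: mean_is_sum => i.
  have := mean_isD (mean_is_cst P (log2 (1 + rho i * mu i)))
    (mean_isZ (k i) (mean_isD (EX i) (mean_is_cst P (- mu i)))).
  by rewrite subrr mulr0 addr0.
have le_U i w : log2 (1 + rho i * X i w) <= U i w.
  have := ln_le_tangent (pos0 i _ (X0 i w)) (pos0 i _ (mu0 i)).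
  rewrite -(ler_pM2r (x := (ln 2)^-1)) ?invr_gt0// => /le_trans; apply.
  rewrite /U /k /log2 le_eqVlt; apply/orP; left; apply/eqP.
  by field; rewrite !gt_eqF// pos0.
have [_ <-] := EU.
(* This comparison is for nonnegative functions; the tangent sum qualifies because it dominates
   logarithms of numbers at least 1. *)
apply: expectation_le.
- apply: measurable_sum => i.
  apply: measurable_funM; last exact: measurable_cst.
  apply: measurableT_comp; first exact: measurable_ln.
  apply: measurable_funD; first exact: measurable_cst.
  apply: measurable_funM; first exact: measurable_cst.
  exact: mean_is_measurable (EX i).
- exact: mean_is_measurable EU.
- by move=> w; apply: sumr_ge0 => i _; exact/log2_ge0/pos.
- move=> w; apply: sumr_ge0 => i _; apply: le_trans (le_U i w).
  exact/log2_ge0/pos.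
- by apply: aeW => w; apply: ler_sum.
Qed.

End jensen.

(** * Application to the reflected channel *)

Theorem proposition2 (d : measure_display) (T : measurableType d)
    (R : realType) (P : probability T R)
    (Kt S M N : nat)
    (Kt_gt0 : (0 < Kt)%N) (S_gt0 : (0 < S)%N)
    (M_gt0 : (0 < M)%N) (N_gt0 : (0 < N)%N)
    (PT sigma2 : R) (PT_gt0 : 0 < PT) (sigma2_gt0 : 0 < sigma2)
    (Lam : 'I_S -> R) (Lam_ge0 : forall s, 0 <= Lam s)
    (Lam_sum : \sum_(s < S) Lam s = 1)
    (beta : 'I_S -> R) (beta_gt0 : forall s, 0 < beta s)
    (g : 'I_S -> 'I_Kt -> 'I_M -> 'I_N -> T -> R[i])
    (g_RV : forall s k m n, complex_RV (g s k m n))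
    (g_indep : independent_family P
       (fun i : 'I_S * 'I_Kt * 'I_M * 'I_N =>
          let: (s, k, m, n) := i in g s k m n))
    (g_mean : forall s k m n, has_mean P (g s k m n) 0)
    (g_var : forall s k m n, variance_about P 0 (g s k m n) = 1%E)
    (Gam : 'I_S -> 'I_M -> 'I_N -> R[i]) (amp : 'I_S -> R)
    (Gam_amp : forall s m n, cmod (Gam s m n) = amp s) :
  (capacity P PT sigma2 Lam (channel beta g Gam) <=
   (\sum_(s < S)
      log2 (1 + PT / sigma2 * Lam s *
                (beta s * Kt%:R * M%:R * N%:R * amp s ^+ 2)))%:E)%E.
Proof.
pose mu s := beta s * Kt%:R * M%:R * N%:R * amp s ^+ 2.
rewrite /capacity.
apply: (expectation_sum_log2_le (mu := mu)
  (X := fun s w =>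
     cRe ((channel beta g Gam w *m (channel beta g Gam w)^t*) s s))).
- by move=> s; rewrite mulr_ge0 ?divr_ge0// ltW.
- by move=> s w; rewrite Re_mulmx_conj_diag sumr_ge0// => k _; rewrite sqr_ge0.
move=> s.
(* For fixed user and antenna, the surface elements form one family indexed by pairs, with weights
   [Gam s]. *)
have Emn k : mean_is P
    (fun w =>
       cmod (\sum_(i : 'I_M * 'I_N) g s k i.1 i.2 w * Gam s i.1 i.2) ^+ 2)
    (\sum_(i : 'I_M * 'I_N) cmod (Gam s i.1 i.2) ^+ 2).
  apply: (mean_is_normc_sqr_sum (Z := fun i => g s k i.1 i.2)) => // i j B C ij.
  apply: (independent_family_pair
    (i := (s, k, i.1, i.2)) (j := (s, k, j.1, j.2)) g_indep).
  by apply: contraNN ij => /eqP[e1 e2]; rewrite -pair_eqE/= e1 e2 !eqxx.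
(* Antennas combine by linearity; the factor [beta s] is the squared modulus of the prefactor in
   [channel]. *)
have := mean_is_sum (index_enum 'I_Kt) (fun k => mean_isZ (beta s) (Emn k)).
congr mean_is.
  apply/funext => w; rewrite Re_mulmx_conj_diag; apply: eq_bigr => k _.
  rewrite mxE ComplexField.Normc.normcM exprMn pair_big/=; congr (_ * _).
  by rewrite expr0n addr0 sqrtr_sqr ger0_norm ?sqrtr_ge0// sqr_sqrtr// ltW.
(* With a common amplitude both sums become counts, [Kt] and [M * N]. *)
under eq_bigr => k _ do under eq_bigr => i _ do rewrite Gam_amp.
rewrite !sumr_const !card_ord card_prod !card_ord /mu.
rewrite -[LHS]mulr_natr -[amp s ^+ 2 *+ _]mulr_natr natrM; ring.
Qed.
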